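(* Let $G=(U,V,E)$ be a bipartite graph, let $a,b\in U\cup V$ be vertices of $G$, and let $d(a,b)$ be the distance between $a$ and $b$ in $G$ (with $d(a,b)=\infty$ if $a$ and $b$ lie in different connected components). If $d(a,b)\ge 4$, then there is an optimal solution of the Bicluster Graph Editing Problem with input $G$ in which $a$ and $b$ belong to distinct biclusters.
   Context: All graphs are finite and simple. A bipartite graph $G=(U,V,E)$ has non-empty disjoint stable sets $U$ and $V$ as parts, and every edge in $E$ joins a vertex of $U$ to a vertex of $V$. A bicluster graph is a bipartite graph in which every connected component is a biclique (complete bipartite graph); a single vertex counts as a biclique. The connected components of a bicluster graph are called its biclusters. Bicluster Graph Editing Problem (BGEP): given $G=(U,V,E)$, an edge editing operation either removes an existing edge of $E$ or adds a new edge between a vertex of $U$ and a vertex of $V$. The goal is to transform $G$ into a bicluster graph, on the same parts $U$ and $V$, using a minimum number of edge editing operations. A feasible solution is a bicluster graph $G'=(U,V,E')$; its cost is $|E\setminus E'|+|E'\setminus E|$. An optimal solution is a feasible solution of minimum cost. *)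

(* Defs.v *)
From HB Require Import structures.
From mathcomp Require Import all_boot.

Set Implicit Arguments.
Unset Strict Implicit.
Unset Printing Implicit Defensive.

(** A bipartite graph with parts the finite types [U] and [V] is given by its
    edge set [E : {set U * V}]; its vertex type is the disjoint sum [U + V]. *)

Section Bipartite.
Variables U V : finType.
Implicit Types (E F : {set U * V}) (x y a b : U + V) (C : {set U + V}).

Definition adj E : rel (U + V) := fun x y =>
  match x, y with
  | inl u, inr v => (u, v) \in E
  | inr v, inl u => (u, v) \in E
  | _, _ => false
  end.

Definition component E x : {set U + V} := [set y | connect (adj E) x y].

Definition components E : {set {set U + V}} := [set component E x | x : U + V].

(** Both sides of a complete bipartite graph are nonempty, so the one-vertex
    case has to be listed separately. *)
Definition is_biclique E C : bool :=
  (#|C| == 1) ||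
  [&& [exists u : U, inl u \in C],
      [exists v : V, inr v \in C] &
      [forall u : U, forall v : V,
         (inl u \in C) && (inr v \in C) ==> ((u, v) \in E)]].

Definition is_bicluster_graph E : bool :=
  [forall C in components E, is_biclique E C].

Definition edit_cost E F : nat := #|E :\: F| + #|F :\: E|.

Definition is_optimal_solution E F : Prop :=
  is_bicluster_graph F /\
  forall F', is_bicluster_graph F' -> edit_cost E F <= edit_cost E F'.

Definition has_walk E x y (n : nat) : bool :=
  [exists p : n.-tuple (U + V), path (adj E) x p && (last x p == y)].

Lemma connect_has_walk E x y : connect (adj E) x y -> exists n, has_walk E x y n.
Proof.
case/connectP=> p xp ->; exists (size p).
by apply/existsP; exists (in_tuple p); rewrite /= xp eqxx.
Qed.

(** [None] stands for the infinite distance between distinct components. *)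
Definition dist E x y : option nat :=
  match @idP (connect (adj E) x y) with
  | ReflectT xy => Some (ex_minn (connect_has_walk xy))
  | ReflectF _ => None
  end.

Definition dist_at_least (k : nat) (d : option nat) : bool :=
  if d is Some n then k <= n else true.

End Bipartite.

(* Main.v *)
Require Import Defs.
From mathcomp Require Import all_boot.

(** Bicluster graphs are exactly the bipartite graphs in which the ends of
    every walk of length 3 are adjacent ([is_bicluster_graphP]).  This property
    survives when all the edges between a vertex set [S] and its complement are
    deleted ([bicluster_uncut]), and such a deletion does not increase the
    editing cost as soon as the deleted edges outside [E] are at least as many
    as the deleted edges of [E] ([edit_cost_uncut]).

    Start from an optimal solution [F] and suppose that [a] and [b] lie in the
    same bicluster of [F].  It suffices to find a profitable [S] containing
    exactly one of [a] and [b].  If at least half of the [F]-edges at [a] are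
    not in [E], then [S] = {[a]} works, and similarly for [b].

    When [a] and [b] are in the same part, they have the same [F]-neighbours
    but no common [E]-neighbour, so one of the two singletons is profitable
    ([profitable_cut_common_nbr]).

    When [a] and [b] are in different parts, they are adjacent in [F].  Let
    [X1], [X2] be the [F]-neighbours of [b] that are not, respectively are,
    [E]-neighbours of [b], and let [Y2], [Y1] be the corresponding sets for
    [a].  If neither singleton is profitable, then |X1| < |X2| and |Y2| < |Y1|.
    Separating [X1] and [Y1] from [X2] and [Y2] deletes the pairs of X1 x Y2 and
    X2 x Y1.  The latter contain no edge of [E], because such an edge would
    give a walk of length 3 from [a] to [b] in [E]; and
    |X1| |Y2| <= |X2| |Y1| ([profitable_cut_adj]). *)

Set Implicit Arguments.
Unset Strict Implicit.
Unset Printing Implicit Defensive.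

Section BiclusterEditing.
Variables U V : finType.
Implicit Types (D E F : {set U * V}) (a b x y z w : U + V) (S : {set U + V}).

(** * Walks and distance *)

Lemma adj_sym E : symmetric (adj E).
Proof. by case=> [u|v] [u'|v']. Qed.

Lemma walk_dist k E x p :
  dist_at_least k (dist E x (last x p)) -> path (adj E) x p -> k <= size p.
Proof.
move=> far_xp xp; have xp_conn: connect (adj E) x (last x p).
  by apply/connectP; exists p.
move: far_xp; rewrite /dist; case: {-}_ / idP => // conn.
case: ex_minnP => m _ min_m /= le_km; apply: leq_trans le_km (min_m _ _).
by apply/existsP; exists (in_tuple p); rewrite /= xp eqxx.
Qed.

(** * Bicluster graphs as graphs closed under walks of length 3 *)

(** The ends of every walk of length 3 are adjacent. *)
Definition walk3_closed E : Prop :=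
  forall x y z w, adj E x y -> adj E y z -> adj E z w -> adj E x w.

(** A shortest walk in such a graph has length at most 2. *)
Lemma walk3_closed_connect E x y : walk3_closed E -> connect (adj E) x y ->
  [\/ x = y, adj E x y | exists2 z, adj E x z & adj E z y].
Proof.
move=> E3 /connectP[p]; elim/last_ind: p y => [|p z IHp] y /=.
  by move=> _ ->; constructor 1.
rewrite rcons_path last_rcons => /andP[xp pz] ->.
case: (IHp _ xp erefl) => [xE | xlast | [t xt tlast]].
- by constructor 2; rewrite xE.
- by constructor 3; exists (last x p).
- by constructor 2; exact: E3 xt tlast pz.
Qed.

Lemma is_bicluster_graphP E : reflect (walk3_closed E) (is_bicluster_graph E).
Proof.
apply: (iffP forall_inP) => [bicl | E3 C /imsetP[x _ ->{C}]].
  have E3 u v u' v' :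
      (u, v) \in E -> (u', v) \in E -> (u', v') \in E -> (u, v') \in E.
    move=> uv u'v u'v'; pose C := component E (inl u).
    have uC: inl u \in C by rewrite inE connect0.
    have vC: inr v \in C by rewrite inE; apply: connect1.
    have v'C: inr v' \in C.
      rewrite inE; apply/connectP.
      by exists [:: inr v; inl u'; inr v'] => //=; rewrite uv u'v u'v'.
    have /bicl/orP[/cards1P[t Ct] | /and3P[_ _ /forallP/(_ u)/forallP/(_ v')]] :
        C \in components E by apply: imset_f.
      by move: uC vC; rewrite Ct !inE => /eqP<-.
    by rewrite uC v'C.
  by case=> [u|v] [u'|v'] [u2|v2] [u3|v3] //= h1 h2 h3;
     [exact: E3 h1 h2 h3 | exact: E3 h3 h2 h1].
apply/orP; have [->|] := eqVneq (component E x) [set x].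
  by left; rewrite cards1.
rewrite eqEsubset sub1set inE connect0 andbT => /subsetPn[y].
rewrite !inE => xy y'x; right.
have [z xz]: exists z, adj E x z.
  case: (walk3_closed_connect E3 xy) => [xE | xz | [z xz _]].
  - by rewrite xE eqxx in y'x.
  - by exists y.
  - by exists z.
apply/and3P; split.
- apply/existsP; case: x z xz {xy y'x} => [u|v] [u'|v'] //= xz.
    by exists u; rewrite inE connect0.
  by exists u'; rewrite inE; apply: connect1.
- apply/existsP; case: x z xz {xy y'x} => [u|v] [u'|v'] //= xz.
    by exists v'; rewrite inE; apply: connect1.
  by exists v; rewrite inE connect0.
apply/forallP=> u; apply/forallP=> v; rewrite !inE; apply/implyP=> /andP[xu xv].
have uv: connect (adj E) (inl u) (inr v).
  by apply: connect_trans xv; rewrite (sym_connect_sym (@adj_sym E)).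
by case: (walk3_closed_connect E3 uv) => // -[[t|t]].
Qed.

Lemma is_bicluster_graph0 : is_bicluster_graph (set0 : {set U * V}).
Proof.
by apply/is_bicluster_graphP=> -[u|v] [u'|v'] z w //=; rewrite inE.
Qed.

Lemma optimal_solution_exists E : exists F, is_optimal_solution E F.
Proof.
case: (arg_minnP (edit_cost E) is_bicluster_graph0) => F bicl_F min_F.
by exists F.
Qed.

(** * Deleting an edge cut *)

(** The edges of [D] with exactly one end in [S]. *)
Definition cut D S : {set U * V} :=
  [set e in D | (inl e.1 \in S) (+) (inr e.2 \in S)].

Lemma adj_uncut F S x y :
  adj (F :\: cut F S) x y = adj F x y && ((x \in S) == (y \in S)).
Proof.
case: x y => [u|v] [u'|v'] //=; rewrite !inE /=.
  by case: (_ \in F); case: (inl _ \in S); case: (inr _ \in S).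
by case: (_ \in F); case: (inl _ \in S); case: (inr _ \in S).
Qed.

Lemma connect_uncut F S x y :
  connect (adj (F :\: cut F S)) x y -> (x \in S) = (y \in S).
Proof.
case/connectP=> p + ->; elim: p x => //= z p IHp x /andP[xz zp].
by move: xz; rewrite adj_uncut => /andP[_ /eqP->]; apply: IHp.
Qed.

Lemma bicluster_uncut F S :
  is_bicluster_graph F -> is_bicluster_graph (F :\: cut F S).
Proof.
move=> /is_bicluster_graphP F3; apply/is_bicluster_graphP=> x y z w.
rewrite !adj_uncut => /andP[xy /eqP->] /andP[yz /eqP->] /andP[zw ->].
by rewrite andbT; exact: F3 xy yz zw.
Qed.

Lemma edit_cost_uncut E F S : #|cut (F :&: E) S| <= #|cut (F :\: E) S| ->
  edit_cost E (F :\: cut F S) <= edit_cost E F.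
Proof.
move=> le_cut; rewrite /edit_cost -(cardsID (cut F S) (F :\: E)) addnA.
have ->: (F :\: E) :&: cut F S = cut (F :\: E) S.
  by apply/setP=> e; rewrite !inE; case: (e \in F); case: (e \in E).
have ->: (F :\: E) :\: cut F S = (F :\: cut F S) :\: E.
  by apply/setP=> e; rewrite !inE; case: (e \in F); case: (e \in E);
     rewrite ?andbF.
rewrite leq_add2r; apply: leq_trans (leq_add (leqnn _) le_cut).
apply: leq_trans (leq_card_setU _ _); apply/subset_leq_card/subsetP=> e.
by rewrite !inE; case: (e \in F); case: (e \in E); case: (_ (+) _).
Qed.

(** The neighbourhood of [x] in [D]. *)
Definition nbr D x : {set U + V} := [set y | adj D x y].

Lemma nbrI E F x : nbr (F :&: E) x = nbr F x :&: nbr E x.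
Proof.
by apply/setP=> y; rewrite !inE; case: x y => [u|v] [u'|v'] //=; rewrite inE.
Qed.

Lemma nbrD E F x : nbr (F :\: E) x = nbr F x :\: nbr E x.
Proof.
by apply/setP=> y; rewrite !inE; case: x y => [u|v] [u'|v'] //=; rewrite inE.
Qed.

Lemma card_cut1 D x : #|cut D [set x]| = #|nbr D x|.
Proof.
case: x => [u|v].
  have ->: nbr D (inl u) = (fun e => inr e.2) @: cut D [set inl u].
    apply/setP=> y; rewrite inE; apply/idP/imsetP => [|[[u' v']]].
      by case: y => //= v uv; exists (u, v); rewrite // !inE /= uv eqxx.
    by rewrite !inE /= addbF => /andP[u'v' /eqP[<-]] ->.
  rewrite card_in_imset // => -[u1 v1] [u2 v2]; rewrite !inE /= !addbF.
  by move=> /andP[_ /eqP[->]] /andP[_ /eqP[->]] [->].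
have ->: nbr D (inr v) = (fun e => inl e.1) @: cut D [set inr v].
  apply/setP=> y; rewrite inE; apply/idP/imsetP => [|[[u' v']]].
    by case: y => //= u uv; exists (u, v); rewrite // !inE /= uv eqxx.
  by rewrite !inE /= => /andP[u'v' /eqP[<-]] ->.
rewrite card_in_imset // => -[u1 v1] [u2 v2]; rewrite !inE /=.
by move=> /andP[_ /eqP[->]] /andP[_ /eqP[->]] [->].
Qed.

(** * Profitable cuts *)

(** Deleting from [F] the edges between some [S] and its complement separates
    [a] from [b] and does not increase the cost with respect to [E]. *)
Definition profitable_cut E F a b : Prop :=
  exists2 S : {set U + V}, (a \in S) != (b \in S) &
    #|cut (F :&: E) S| <= #|cut (F :\: E) S|.

Lemma profitable_cut_sym E F a b :
  profitable_cut E F a b -> profitable_cut E F b a.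
Proof. by case=> S Sab le_cut; exists S; rewrite // eq_sym. Qed.

Lemma profitable_cut1 E F a b :
  a != b -> #|nbr (F :&: E) a| <= #|nbr (F :\: E) a| -> profitable_cut E F a b.
Proof.
move=> a'b le_nbr; exists [set a]; last by rewrite !card_cut1.
by rewrite !inE eqxx (eq_sym b) (negPf a'b).
Qed.

(** The vertices [a] and [b] have the same [F]-neighbours, and these split into
    disjoint sets of [E]-neighbours of [a] and of [b], and a remainder; so one
    of the two has at most half of its [F]-neighbours among its
    [E]-neighbours. *)
Lemma profitable_cut_common_nbr E F a b z :
    walk3_closed F -> adj F a z -> adj F z b -> a != b ->
    (forall y, adj E a y -> adj E y b -> False) ->
  profitable_cut E F a b.
Proof.
move=> F3 az zb a'b no_common.
have nbrF: nbr F a = nbr F b.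
  apply/setP=> y; rewrite !inE; apply/idP/idP; last exact: F3 az zb.
  by apply: (F3 b z a y); rewrite adj_sym.
have [le_a|lt_a] := leqP #|nbr (F :&: E) a| #|nbr (F :\: E) a|.
  exact: profitable_cut1.
apply/profitable_cut_sym/profitable_cut1; first by rewrite eq_sym.
have disj y : y \in nbr E a -> y \notin nbr E b.
  by rewrite !inE => ay; apply/negP; rewrite adj_sym; apply: no_common.
move: lt_a; rewrite !nbrI !nbrD nbrF => lt_a.
apply: (@leq_trans #|nbr F b :\: nbr E a|).
  apply/subset_leq_card/subsetP=> y; rewrite in_setI in_setD => /andP[-> Eby].
  by rewrite andbT; apply: contraL Eby => /disj.
apply: leq_trans (ltnW lt_a) _.
apply/subset_leq_card/subsetP=> y; rewrite in_setI in_setD => /andP[-> /disj->].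
by [].
Qed.

(** If isolating neither vertex is profitable, the bicluster of [F] containing
    them is split in two: one part consists of its vertices that are
    [E]-neighbours of [inl u] and, on the other side, of those that are not
    [E]-neighbours of [inr v], among them [inl u]. *)
Lemma profitable_cut_adj E F u v :
    walk3_closed F -> (u, v) \in F -> (u, v) \notin E ->
    (forall u' v', (u, v') \in E -> (u', v') \in E -> (u', v) \in E -> False) ->
  profitable_cut E F (inl u) (inr v).
Proof.
move=> F3 uvF uvE no_walk; set a := inl u; set b := inr v.
have F3' u1 v1 u2 v2 :
    (u1, v1) \in F -> (u2, v1) \in F -> (u2, v2) \in F -> (u1, v2) \in F.
  exact: (F3 (inl u1) (inr v1) (inl u2) (inr v2)).
have [le_a|lt_a] := leqP #|nbr (F :&: E) a| #|nbr (F :\: E) a|.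
  exact: profitable_cut1.
have [le_b|lt_b] := leqP #|nbr (F :&: E) b| #|nbr (F :\: E) b|.
  exact/profitable_cut_sym/profitable_cut1.
(* This set contains [a], as a nonneighbour of [b] in [E], but not [b]. *)
exists (nbr (F :\: E) b :|: nbr (F :&: E) a).
  by rewrite !inE /= !inE uvF (negPf uvE).
pose ends (e : U * V) : (U + V) * (U + V) := (inl e.1, inr e.2).
have ends_inj: injective ends by case=> ? ? [? ?] [-> ->].
rewrite -2!(card_imset _ ends_inj).
(* A cut edge of [E] joins a nonneighbour of [b] to a nonneighbour of [a]: if it
   joined neighbours, it would close a walk of length 3 from [a] to [b]. *)
apply: (@leq_trans #|setX (nbr (F :\: E) b) (nbr (F :\: E) a)|).
  apply/subset_leq_card/subsetP=> _ /imsetP[[u' v'] + ->].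
  rewrite !inE /= !inE orbF => /andP[/andP[F' E']].
  case: (boolP ((u', v) \in F)) => [u'vF | u'vF].
    have uv'F: (u, v') \in F := F3' _ _ _ _ uvF u'vF F'.
    rewrite uv'F !andbT /= => cutE.
    case: (boolP ((u, v') \in E)) cutE => [uv'E|_]; last by rewrite addbF andbT.
    by rewrite addbT negbK => u'vE; case: (no_walk u' v' uv'E E' u'vE).
  rewrite andbF => /andP[uv'F _].
  by case/negP: u'vF; exact: (F3' _ _ _ _ F' uv'F uvF).
apply: (@leq_trans #|setX (nbr (F :&: E) b) (nbr (F :&: E) a)|).
  by rewrite !cardsX leq_mul // ltnW.
apply/subset_leq_card/subsetP=> -[[u'|v1] [u1|v']]; rewrite !inE ?andbF //=.
rewrite !inE => /andP[/andP[u'vF u'vE] /andP[uv'F uv'E]].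
apply/imsetP; exists (u', v') => //; rewrite !inE /= !inE.
rewrite u'vF u'vE uv'F uv'E (F3' _ _ _ _ u'vF uvF uv'F) /= andbT.
by apply/andP; split=> //; apply/negP=> u'v'E; apply: (no_walk u' v').
Qed.

Lemma profitable_cut_far E F a b :
    is_bicluster_graph F -> connect (adj F) a b ->
    dist_at_least 4 (dist E a b) ->
  profitable_cut E F a b.
Proof.
move=> /is_bicluster_graphP F3 Fab far_ab.
have far p : path (adj E) a p -> last a p = b -> 3 < size p.
  by move=> ap lastb; apply: walk_dist ap; rewrite lastb.
have a'b: a != b by apply/eqP=> ab; have := far [::] isT ab.
case: (walk3_closed_connect F3 Fab) => [ab | adj_ab | [z az zb]].
- by rewrite ab eqxx in a'b.
- have no_edge: ~~ adj E a b.
    by apply/negP=> ab; have := far [:: b]; rewrite /= ab => /(_ isT erefl).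
  have no_walk x y : adj E a x -> adj E x y -> adj E y b -> False.
    move=> ax xy yb; have := far [:: x; y; b]; rewrite /= ax xy yb.
    by move=> /(_ isT erefl).
  case: a b adj_ab no_edge no_walk {Fab far_ab far a'b}.
    move=> u [//|v] uvF uvE no_walk.
    apply: profitable_cut_adj => // u' v'.
    exact: (no_walk (inr v') (inl u')).
  move=> v [u|//] uvF uvE no_walk.
  apply/profitable_cut_sym/profitable_cut_adj => // u' v' uv' u'v' u'v.
  exact: (no_walk (inl u') (inr v')).
apply: profitable_cut_common_nbr az zb a'b _ => // y ay yb.
by have := far [:: y; b]; rewrite /= ay yb => /(_ isT erefl).
Qed.

End BiclusterEditing.

Theorem theorem1 (U V : finType) (E : {set U * V}) (a b : U + V)
  (U_nonempty : 0 < #|U|) (V_nonempty : 0 < #|V|)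
  (dist_ab : dist_at_least 4 (dist E a b)) :
  exists F : {set U * V},
    is_optimal_solution E F /\
    exists A B : {set U + V},
      [/\ A \in components F, B \in components F, a \in A, b \in B & A != B].
Proof.
suff [F optF ab]: exists2 F, is_optimal_solution E F & ~~ connect (adj F) a b.
  exists F; split=> //; exists (component F a), (component F b).
  split; rewrite ?imset_f // ?inE ?connect0 //.
  by apply: contraNneq ab => eq_ab; have := connect0 (adj F) b;
     move/setP/(_ b): eq_ab; rewrite !inE => ->.
have [F optF] := optimal_solution_exists E.
have [Fab|] := boolP (connect (adj F) a b); last by exists F.
case: (optF) => bicl_F min_F.
have [S Sab le_cut] := profitable_cut_far bicl_F Fab dist_ab.
exists (F :\: cut F S); last by apply: contra Sab => /connect_uncut->.
split=> [|F' bicl_F']; first exact: bicluster_uncut.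
exact: leq_trans (edit_cost_uncut le_cut) (min_F _ bicl_F').
Qed.
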